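(* Let $n \ge 1$ be an integer such that $2n+1$ is a prime number. Then the leading diregular tournament on $2n+1$ points can be decomposed into $n$ directed Hamilton circuits; that is, there exist $n$ directed Hamilton circuits in it such that every directed edge of the tournament belongs to exactly one of these circuits.
   Context: A tournament is a digraph without loops in which every pair of distinct vertices is joined by exactly one directed edge. A diregular tournament on $2n+1$ points is a tournament on $2n+1$ vertices in which every vertex has in-degree $n$ and out-degree $n$. The leading diregular tournament on $2n+1$ points is the digraph with vertices $v_1, v_2, \dots, v_{2n+1}$ and adjacency matrix $[a_{ij}]$, where $a_{ij}=1$ means that there is a directed edge from $v_i$ to $v_j$, and where, for $i,j \in \{1,\dots,2n+1\}$, $a_{ij}=1$ if $j-i$ is congruent modulo $2n+1$ to one of $1,2,\dots,n$, and $a_{ij}=0$ otherwise. A directed Hamilton circuit of a digraph is a directed cycle, following the directions of the edges, that passes through every vertex exactly once. A decomposition of a digraph into directed Hamilton circuits is a collection of pairwise edge-disjoint directed Hamilton circuits whose edge sets together make up all the directed edges of the digraph. *)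

(* Defs.v *)
From mathcomp Require Import all_boot.

Set Implicit Arguments.
Unset Strict Implicit.
Unset Printing Implicit Defensive.

(* The point v_i is the element i - 1 of 'I_(2n+1): the adjacency relation only
   depends on j - i.  The congruence j - i = k is written i + k = j, because
   subtraction on nat is truncated. *)
Definition leading_tournament (n : nat) : rel 'I_n.*2.+1 :=
  fun i j => has (fun k => i + k == j %[mod n.*2.+1]) (iota 1 n).

(* A circuit is given by the cyclic list of its vertices, the last one being
   followed by the first. *)
Definition hamilton_circuit (T : finType) (e : rel T) (c : seq T) : Prop :=
  ucycle e c /\ forall x, x \in c.

Definition circuit_edges (T : finType) (c : seq T) : {set T * T} :=
  [set p | (p.1 \in c) && (p.2 == next c p.1)].

(* Each circuit only uses edges of e (see ucycle), so with the uniqueness below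
   the edge sets of the circuits partition the edge set of e. *)
Definition hamilton_decomposition (T : finType) (e : rel T) (m : nat)
    (c : 'I_m -> seq T) : Prop :=
  (forall k, hamilton_circuit e (c k)) /\
  (forall x y, e x y -> exists! k, (x, y) \in circuit_edges (c k)).

(* Main.v *)
Require Import Defs.
From mathcomp Require Import all_boot.
From mathcomp Require Import zmodp.

(** The edges of the leading tournament split by their length, the element [d]
    of [1, n] with [i + d = j] modulo [p := 2n+1].  The edges of a fixed length
    [d] are the graph of the rotation [x |-> x + d] of the integers modulo [p],
    and as [0 < d < p] with [p] prime, [d] is coprime to [p], so that the rotation
    is a single cycle through all points ([orbit_rotate]).  Hence each of the
    [n] lengths gives one Hamilton circuit ([next_orbit_rotate] says that its
    edges are all the edges of that length), and an edge lies on the circuit of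
    its own length only, because a length is determined modulo [p] and is at
    most [n < p]. *)

Definition rotate {m} d (x : 'I_m.+1) : 'I_m.+1 := inZp (x + d).

Lemma rotate_eq {m} d (x y : 'I_m.+1) :
  (rotate d x == y) = (x + d == y %[mod m.+1]).
Proof. by rewrite -val_eqE /= (modn_small (ltn_ord y)). Qed.

Lemma rotate_inj {m} d : injective (@rotate m d).
Proof.
move=> x y /(congr1 val) /= /eqP.
by rewrite eqn_modDr !modn_small // => /eqP/val_inj.
Qed.

Lemma iter_rotate {m} d j (x : 'I_m.+1) :
  iter j (rotate d) x = rotate (j * d) x.
Proof.
apply: val_inj; elim: j => [|j IHj] /=.
  by rewrite mul0n addn0 modn_small.
by rewrite IHj /= modnDml mulSn addnAC addnA.
Qed.

(** The Chinese remainder theorem supplies a multiple of [d] congruent to any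
    given [x] modulo [m.+1]; dividing it by [d] tells how many rotations lead
    from 0 to [x]. *)
Lemma orbit_rotate {m d} (x : 'I_m.+1) :
  coprime m.+1 d -> x \in orbit (rotate d) ord0.
Proof.
move=> co_m_d; rewrite -fconnect_orbit.
set t := chinese m.+1 d x 0.
have d_dv_t : d %| t by rewrite /dvdn chinese_modr // mod0n.
suff -> : x = iter (t %/ d) (rotate d) ord0 by apply: fconnect_iter.
apply/esym/eqP.
by rewrite iter_rotate divnK // rotate_eq add0n chinese_modl.
Qed.

Lemma next_orbit_rotate {m d} (x : 'I_m.+1) :
  coprime m.+1 d -> next (orbit (rotate d) ord0) x = rotate d x.
Proof.
move=> co_m_d; have cyc := cycle_orbit (@rotate_inj m d) ord0.
by have /eqP := next_cycle cyc (orbit_rotate x co_m_d).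
Qed.

Lemma rotate_length_inj {m d e} {x : 'I_m.+1} :
  d <= m -> e <= m -> rotate d x = rotate e x -> d = e.
Proof.
move=> le_dm le_em /(congr1 val) /= /eqP.
by rewrite eqn_modDl !modn_small // => /eqP.
Qed.

Lemma leading_tournamentP {n} {x y : 'I_n.*2.+1} :
  reflect (exists k : 'I_n, rotate k.+1 x = y) (@leading_tournament n x y).
Proof.
apply: (iffP hasP) => [[[|k]] | [k kxy]].
- by rewrite mem_iota.
- rewrite mem_iota add1n ltnS => /= lt_kn xy; exists (Ordinal (lt_kn : k < n)).
  by apply/eqP; rewrite rotate_eq.
- exists k.+1; first by rewrite mem_iota /= add1n ltnS ltn_ord.
  by rewrite -rotate_eq kxy.
Qed.

Theorem theorem2p1 (n : nat) (n_ge1 : 1 <= n) (prime_2n1 : prime n.*2.+1) :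
  exists c : 'I_n -> seq 'I_n.*2.+1,
    hamilton_decomposition (@leading_tournament n) c.
Proof.
have le_k (k : 'I_n) : k.+1 <= n.*2.
  by rewrite -addnn (leq_trans (ltn_ord k)) ?leq_addr.
have co_k (k : 'I_n) : coprime n.*2.+1 k.+1.
  by rewrite prime_coprime // gtnNdvd // ltnS le_k.
exists (fun k : 'I_n => orbit (rotate k.+1) ord0); split=> [k | x y].
  split=> [|x]; last exact: orbit_rotate.
  rewrite /ucycle orbit_uniq andbT.
  have := cycle_orbit (@rotate_inj n.*2 k.+1) ord0.
  apply: sub_cycle => x y /= /eqP kxy.
  by apply/leading_tournamentP; exists k.
move=> /leading_tournamentP[k kxy]; exists k; split=> [|l].
  by rewrite inE /= orbit_rotate // next_orbit_rotate // kxy eqxx.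
rewrite inE /= next_orbit_rotate // => /andP[_ /eqP lxy].
apply: val_inj; apply: succn_inj.
by apply: (rotate_length_inj (le_k k) (le_k l)) (etrans kxy lxy).
Qed.
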